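(* Let $L$ be a lattice of rank $g$ and $Q$ a positive-definite quadratic form on $L_{\mathbb R}$. Then $Q$ is matroidal if and only if all of its conorms are nonnegative, i.e. $\lambda_e(Q)\ge 0$ for all $0\ne e\in V^*$.
   Context: A lattice $L$ of rank $g$ is a free abelian group of rank $g$; $L_{\mathbb R}=L\otimes_{\mathbb Z}\mathbb R$, $L^*=\mathrm{Hom}(L,\mathbb Z)$. Put $V=L/2L$ and $V^*=\mathrm{Hom}_{\mathbb F_2}(V,\mathbb F_2)$; $[x]\in V$ is the class of $x\in L$. Vonorms: $\mu_Q(\alpha)=\min\{Q[x]:x\in L,\ [x]=\alpha\}$ for $\alpha\in V$, where $Q[x]$ is the value of $Q$ at $x$. Conorms: $\lambda_e(Q)=-2^{1-g}\sum_{\alpha\in V}(-1)^{e(\alpha)}\mu_Q(\alpha)$ for $0\ne e\in V^*$. A finite family $(a_e)_{e\in E}$ in $L^*$ is unimodular if, after choosing an integral basis of $L$, every maximal ($g\times g$) minor of the matrix whose columns are the $a_e$ is $0$ or $\pm1$. A positive-definite $Q$ is matroidal if it admits a decomposition $Q=\sum_{e\in E}\lambda_e a_e^2$ with $\lambda_e>0$ for some finite unimodular family $(a_e)_{e\in E}$ in $L^*$. *)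

(* Defs.v *)
From HB Require Import structures.
From mathcomp Require Import all_boot all_order all_algebra.
From mathcomp Require Import all_classical all_reals.
From mathcomp Require Import lra zify.

Set Implicit Arguments.
Unset Strict Implicit.
Unset Printing Implicit Defensive.

Import Order.TTheory GRing.Theory Num.Theory.
Local Open Scope classical_set_scope.
Local Open Scope ring_scope.

(* A lattice of rank g is written in coordinates with respect to an integral
   basis, so that L is Z^g and its real extension is R^g. *)
Notation lattice g := 'rV[int]_g.
Notation lattice_dual g := 'Hom('rV[int]_g, int^o).

(* L / 2L and its F_2-dual; see [mod2_eq] and [mod2_surj]. *)
Notation lattice_mod2 g := 'rV['F_2]_g.
Notation lattice_mod2_dual g := 'Hom('rV['F_2]_g, ('F_2)^o).

Definition mod2 (g : nat) (x : lattice g) : lattice_mod2 g :=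
  map_mx (fun z : int => z%:~R) x.

Lemma mod2_eq (g : nat) (x y : lattice g) :
  mod2 x = mod2 y <-> exists z : lattice g, x - y = z *+ 2.
Proof.
have intr2 (k : int) : (k%:~R == 0 :> 'F_2) = (2 %| k)%Z.
  rewrite dvdzE (dvdn_pcharf (pchar_Fp (isT : prime 2))).
  by case: k => n //; rewrite NegzE mulrNz oppr_eq0.
split=> [/matrixP exy | [z /matrixP exy]]; last first.
  apply/matrixP=> i j; rewrite !mxE; apply/eqP; rewrite -subr_eq0 -intrB intr2.
  have := exy i j; rewrite mxE [(- y) i j]mxE => ->.
  by apply/dvdzP; exists (z i j); rewrite mulr2n mxE mulrDr mulr1.
exists (map_mx (fun k => (k %/ 2)%Z) (x - y)); apply/matrixP=> i j.
have /eqP := exy i j; rewrite [mod2 x i j]mxE [mod2 y i j]mxE.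
rewrite -subr_eq0 -intrB intr2 => d.
have e : (x - y) i j = x i j - y i j by rewrite !mxE.
rewrite mulr2n [RHS]mxE [map_mx _ _ i j]mxE e -{1}(divzK d).
by rewrite mulrDr mulr1.
Qed.

Lemma mod2_surj (g : nat) (alpha : lattice_mod2 g) :
  exists x : lattice g, mod2 x = alpha.
Proof.
exists (map_mx (fun t : 'F_2 => Posz t) alpha).
by apply/matrixP=> i j; rewrite !mxE -pmulrn natr_Zp.
Qed.

Definition realify (R : realType) (g : nat) (x : lattice g) : 'rV[R]_g :=
  map_mx (fun z : int => z%:~R) x.

(* The R-linear extension to R^g of an integral linear form. *)
Definition realify_dual (R : realType) (g : nat) (a : lattice_dual g)
    (x : 'rV[R]_g) : R :=
  \sum_(i < g) x 0 i * (a (delta_mx 0 i) : int)%:~R.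

Section QuadraticForms.
Context {R : realType} {g : nat}.
Implicit Type Q : 'rV[R]_g -> R.

Definition quadratic_form Q : Prop :=
  exists B : {symmetric 'rV[R]_g}, forall x, Q x = B x x.

Definition positive_definite Q : Prop :=
  quadratic_form Q /\ forall x : 'rV[R]_g, x != 0 -> 0 < Q x.

(* For positive definite Q the infimum is a minimum, see [vonorm_min]. *)
Definition vonorm Q (alpha : lattice_mod2 g) : R :=
  inf [set Q (realify R x) | x in [set x | mod2 x = alpha]].

Lemma vonorm_min Q (alpha : lattice_mod2 g) : positive_definite Q ->
  exists2 x : lattice g, mod2 x = alpha &
    vonorm Q alpha = Q (realify R x) /\
    forall y : lattice g, mod2 y = alpha -> vonorm Q alpha <= Q (realify R y).
Proof.
case=> -[B QB] Qgt0.
have Q_ge0 x : 0 <= Q x.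
  by have [->|/Qgt0/ltW//] := eqVneq x 0; rewrite QB linear0l.
have CS u v : B u v ^+ 2 <= B u u * B v v.
  have [->|v0] := eqVneq v 0; first by rewrite linear0r !linear0l expr0n mulr0.
  have Bv : 0 < B v v by rewrite -QB Qgt0.
  have sB : B v u = B u v by rewrite hermC expr0 mul1r.
  have := Q_ge0 (B v v *: u - B u v *: v).
  rewrite QB linearBl !linearBr !linearZl_LR !linearZr /= sB.
  by move=> h; rewrite -(ler_pM2l Bv); nra.
have coord i : exists K : R, forall x : 'rV[R]_g, x 0 i ^+ 2 <= K * Q x.
  pose A := \matrix_(k, l) B (delta_mx 0 k) (delta_mx 0 l) : 'M[R]_g.
  have BA x y : B x y = (x *m A *m y^T) 0 0.
    rewrite {1}(row_sum_delta x) {1}(row_sum_delta y) linear_sumlz mxE.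
    under [RHS]eq_bigr do rewrite mxE mulr_suml.
    rewrite exchange_big /=; apply: eq_bigr => k _.
    rewrite linearZl_LR linear_sumr /= mulr_sumr; apply: eq_bigr => l _.
    by rewrite linearZr /= !mxE mulrCA mulrC.
  have uA : A \in unitmx.
    rewrite -row_free_unit; apply: inj_row_free => v vA.
    have [//|/Qgt0] := eqVneq v 0.
    by rewrite QB BA vA mul0mx mxE ltxx.
  pose u : 'rV[R]_g := delta_mx 0 i *m invmx A.
  exists (B u u) => x.
  have -> : x 0 i = B u x.
    by rewrite BA mulmxKV // -rowE !mxE.
  by rewrite QB; exact: CS.
have [K coordK] := fin_all_exists coord.
have [x0 ax0] := mod2_surj alpha.
pose c := Q (realify R x0).
pose N := \max_(i < g) (Num.bound (`|K i| * c)).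
have bnd (y : lattice g) i : Q (realify R y) <= c -> (`|y 0%R i| <= N)%N.
  move=> yc; apply: (@leq_trans (Num.bound (`|K i| * c))); last exact: leq_bigmax.
  rewrite leqNgt; apply/negP => lt.
  have h1 : (realify R y) 0 i ^+ 2 <= `|K i| * c.
    apply: le_trans (coordK i _) _.
    by rewrite (le_trans (ler_wpM2r (Q_ge0 _) (ler_norm _)))// ler_wpM2l.
  have h2 : `|K i| * c < (Num.bound (`|K i| * c))%:R.
    by rewrite archi_boundP// mulr_ge0// Q_ge0.
  have := le_lt_trans h1 h2; rewrite mxE -real_normK ?num_real// -intr_norm.
  rewrite -abszE -pmulrn -natrX ltr_nat; nia.
pose F := {ffun 'I_g -> 'I_(N + N).+1}.
pose L (f : F) : lattice g := \row_i (Posz (f i) - Posz N).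
have LP y : Q (realify R y) <= c -> exists f : F, L f = y.
  move=> yc; exists [ffun i => inord (absz (y 0 i + Posz N))].
  apply/rowP=> i; rewrite mxE ffunE inordK; have := bnd y i yc; lia.
have [f0 Lf0] := LP x0 (lexx _).
have P0 : mod2 (L f0) == alpha by rewrite Lf0 ax0.
case: (arg_minP (P := fun f => mod2 (L f) == alpha)
  (fun f => Q (realify R (L f))) P0) => f /eqP af fmin.
have lb y : mod2 y = alpha -> Q (realify R (L f)) <= Q (realify R y).
  move=> ay; have [yc|/ltW cy] := leP (Q (realify R y)) c.
    by have [h hy] := LP y yc; rewrite -hy; apply: fmin; rewrite hy ay.
  by apply: le_trans cy; rewrite /c -Lf0; exact: fmin.
have vE : vonorm Q alpha = Q (realify R (L f)).
  apply/eqP; rewrite eq_le; apply/andP; split.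
    apply: ge_inf; last by exists (L f).
    by exists 0 => _ [y _ <-].
  apply: lb_le_inf; first by exists (Q (realify R (L f))), (L f).
  by move=> _ [y /= ay <-]; exact: lb.
by exists (L f) => //; rewrite vE; split.
Qed.

Definition conorm Q (e : lattice_mod2_dual g) : R :=
  - 2 ^ (1 - g%:Z) *
    \sum_(alpha : lattice_mod2 g) (-1) ^+ (e alpha : 'F_2) * vonorm Q alpha.

(* The rows of P form an integral basis of L.  The choice of f picks g columns
   of the matrix; non-injective f only contribute vanishing determinants. *)
Definition unimodular_family (E : finType) (a : E -> lattice_dual g) : Prop :=
  exists2 P : 'M[int]_g, P \in unitmx &
    forall f : 'I_g -> E,
      \det (\matrix_(i, j) (a (f j) (row i P) : int)) \in [:: 0; 1; -1].

Definition matroidal Q : Prop :=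
  exists (E : finType) (a : E -> lattice_dual g) (lambda : E -> R),
    [/\ unimodular_family a,
        forall e, 0 < lambda e
      & forall x, Q x = \sum_(e : E) lambda e * realify_dual (a e) x ^+ 2].

End QuadraticForms.

(* Main.v *)
Require Import Defs.
From HB Require Import structures.
From mathcomp Require Import all_boot all_order all_algebra.
From mathcomp Require Import all_classical all_reals.
From mathcomp Require Import ring lra zify.

(** Write V for L / 2L.  Fourier inversion on V turns the conorms back into the
    vonorms: vonorm Q a is the sum of the conorms of the u <> 0 in the dual
    of V with u(a) = 1 ([vonorm_of_conorms]).  So the conorms are nonnegative
    exactly when the vonorms form a nonnegative combination of cut functions
    a |-> [u(a) = 1], and the theorem compares such a combination with a
    decomposition of Q itself.

    Matroidal forms have nonnegative conorms.  Let Q be the sum of the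
    lambda_e a_e^2.  As squares of integers dominate their parities, Q(x) is
    at least the sum of the lambda_e over the e with a_e(x) odd.  This bound is
    attained in each class mod 2: a box with integral bounds on unimodular
    forms that contains a real point contains a lattice point
    ([unimodular_integral_point]), so halving x and rounding gives y = x - 2 z
    with all a_e(y) in {-1, 0, 1}.  Hence the vonorms are the combination of
    the cuts of the a_e mod 2 with weights lambda_e, and each conorm is a sum
    of some of the lambda_e.

    Conversely, suppose that the vonorms are the combination of the cuts of
    the u with weights lam u >= 0, and let the support consist of the u with
    lam u > 0.  Call x in L minimal if Q(x) is the vonorm of its class.  If x, y
    and z are minimal and x + y + z = 2 w, the four vectors w, w - x, w - y and
    w - z have total Q equal to Q(x) + Q(y) + Q(z), while a cut by cut count
    shows that the vonorms of their four classes add up to at least that much.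
    So equality holds everywhere: the four vectors are minimal, and every u in
    the support that vanishes on x and y vanishes on w ([minimal_half_sum]).

    Take a basis u_1, ..., u_g of the dual of V inside the support, and minimal
    vectors X_1, ..., X_g in the classes of the dual basis.  The half-sum
    property, applied to X_i, to a minimal z and to a minimal vector in the
    class of z + X_i, splits z into minimal vectors with fewer odd coordinates;
    by induction z is a combination of the X_i with coefficients in {-1, 0, 1}
    whose parities are the u_i(z) ([minimal_coords]).  A descent shows that
    minimal vectors generate L, so (X_i) is a basis of L.  Its coordinate forms
    lift the u_i to integral forms taking values 0, 1, -1 on minimal vectors.
    As each u in the support belongs to some basis inside the support, every
    such u has a lift w_u of this kind ([support_lift]).

    These lifts are unimodular ([lifts_unimodular]).  If g of them are
    independent mod 2, they evaluate to a diagonal matrix of signs on the dual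
    minimal vectors, so their determinant is a sign.  Otherwise they are all
    even, hence zero, on a nonzero minimal vector.  Finally Q equals
    the sum of the lam u * w_u^2 ([sum_of_lifts]): the two forms agree on every
    minimal vector, in particular on each X_i and on a minimal vector
    +- X_i +- X_j for all i <> j, and these values determine a quadratic
    form. *)

Set Implicit Arguments.
Unset Strict Implicit.
Unset Printing Implicit Defensive.

Import Order.TTheory GRing.Theory Num.Theory.
Local Open Scope ring_scope.

(** * Linear forms as row vectors *)

Section Dot.
Context {K : comNzRingType} {g : nat}.
Implicit Types u v x y : 'rV[K]_g.

Definition dot u x : K := (u *m x^T) 0 0.

Lemma dotE u x : dot u x = \sum_i u 0 i * x 0 i.
Proof. by rewrite /dot mxE; apply: eq_bigr => i _; rewrite mxE. Qed.

Lemma dotC u x : dot u x = dot x u.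
Proof. by rewrite !dotE; apply: eq_bigr => i _; rewrite mulrC. Qed.

Lemma dot_is_linear u : linear (dot u : 'rV[K]_g -> K^o).
Proof. by move=> k x y; rewrite /dot linearP mulmxDr -scalemxAr !mxE. Qed.

HB.instance Definition _ u :=
  GRing.isLinear.Build K 'rV[K]_g K^o _ (dot u) (dot_is_linear u).

Lemma dotDr u x y : dot u (x + y) = dot u x + dot u y.
Proof. exact: (raddfD (dot u)). Qed.

Lemma dotDl u v x : dot (u + v) x = dot u x + dot v x.
Proof. by rewrite dotC dotDr !(dotC x). Qed.

Lemma dotZr c u x : dot u (c *: x) = c * dot u x.
Proof. by rewrite /dot linearZ /= -scalemxAr mxE. Qed.

Lemma dot0r u : dot u 0 = 0.
Proof. exact: (raddf0 (dot u)). Qed.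

Lemma dot_delta u i : dot u (delta_mx 0 i) = u 0 i.
Proof. by rewrite /dot trmx_delta -colE mxE. Qed.

Definition coefs (e : 'Hom('rV[K]_g, K^o)) : 'rV[K]_g :=
  \row_i e (delta_mx 0 i).

Lemma coefsE (e : 'Hom('rV[K]_g, K^o)) x : e x = dot (coefs e) x.
Proof.
rewrite dotE [in LHS](row_sum_delta x) linear_sum /=; apply: eq_bigr => i _.
by rewrite linearZ /= mxE mulrC.
Qed.

Definition dot_form u : 'Hom('rV[K]_g, K^o) :=
  linfun (dot u : 'rV[K]_g -> K^o).

Lemma dot_formE u x : dot_form u x = dot u x.
Proof. by rewrite lfunE. Qed.

Lemma coefsK (e : 'Hom('rV[K]_g, K^o)) : dot_form (coefs e) = e.
Proof. by apply/lfunP => x; rewrite dot_formE coefsE. Qed.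

Lemma dot_formK u : coefs (dot_form u) = u.
Proof. by apply/rowP => i; rewrite mxE dot_formE dot_delta. Qed.

Lemma dot_form_eq0 u : (dot_form u == 0) = (u == 0).
Proof.
apply/eqP/eqP => [e0|->].
  by apply/rowP=> i; rewrite -dot_delta -dot_formE e0 lfunE mxE.
by apply/lfunP=> x; rewrite dot_formE dotC dot0r lfunE.
Qed.

End Dot.

Section SeparatingFamilies.
Variables (F : fieldType) (g : nat).
Implicit Types v : 'rV[F]_g.

Lemma dot_matrix_unit (N : 'M[F]_g) v :
  N \in unitmx -> (forall i, dot (row i N) v = 0) -> v = 0.
Proof.
move=> uN Nv; suff Nv0 : N *m v^T = 0.
  by rewrite -[v]trmxK -(mulKmx uN v^T) Nv0 mulmx0 trmx0.
by apply/colP=> i; rewrite [RHS]mxE -(Nv i) /dot -row_mul !mxE.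
Qed.

Lemma separating_unit (r : 'I_g -> 'rV[F]_g) :
  (forall v, (forall i, dot (r i) v = 0) -> v = 0) -> \matrix_j r j \in unitmx.
Proof.
move=> sep; rewrite -unitmx_tr -row_free_unit; apply: inj_row_free => v vr.
apply: sep => i; have := congr1 (fun m : 'rV_g => m 0 i) vr.
rewrite mxE [RHS]mxE => <-; rewrite dotC dotE.
by apply: eq_bigr => k _; rewrite !mxE.
Qed.

Lemma basis_of_separating (E : finType) (P : pred E) (r : E -> 'rV[F]_g) :
  (forall v, (forall e, P e -> dot (r e) v = 0) -> v = 0) ->
  exists2 f : 'I_g -> E, forall j, P (f j) & \matrix_j r (f j) \in unitmx.
Proof.
move=> sep; pose N := \matrix_(k < #|P|) r (enum_val k).
have fN : row_full N.
  rewrite /row_full -mxrank_tr; apply: inj_row_free => v vN; apply: sep => e Pe.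
  have := congr1 (fun m : 'rV_#|P| => m 0 (enum_rank_in Pe e)) vN.
  rewrite mxE [RHS]mxE => <-; rewrite dotC dotE; apply: eq_bigr => i _.
  by rewrite !mxE enum_rankK_in.
exists (fun j => enum_val (fullrankfun fN j)) => [j|].
  exact: (enum_valP (A := P)).
have := fullrowsub_unit fN; congr (_ \in unitmx).
by apply/matrixP=> i j; rewrite !mxE.
Qed.

End SeparatingFamilies.

(** * Reduction mod 2 *)

Lemma F2_eq0_or_eq1 (t : 'F_2) : t = 0 \/ t = 1.
Proof.
by case: t => [[|[|k]] hk]; [left|right|]; rewrite //; apply: val_inj.
Qed.

Lemma addF2_11 : 1 + 1 = 0 :> 'F_2.
Proof. exact: val_inj. Qed.

Section Mod2.
Variable g : nat.
Implicit Types x y z : lattice g.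

Lemma oppr_F2 (a : lattice_mod2 g) : - a = a.
Proof.
apply/rowP=> i; rewrite mxE.
by case: (F2_eq0_or_eq1 (a 0 i)) => ->; apply: val_inj.
Qed.

Lemma addrr_F2 (a : lattice_mod2 g) : a + a = 0.
Proof. by rewrite -{2}(oppr_F2 a) subrr. Qed.

Lemma mod2D x y : mod2 (x + y) = mod2 x + mod2 y.
Proof. by apply/matrixP=> i j; rewrite !mxE intrD. Qed.

Lemma mod2B x y : mod2 (x - y) = mod2 x + mod2 y.
Proof.
by rewrite -[mod2 y]oppr_F2; apply/matrixP=> i j; rewrite !mxE intrD mulrNz.
Qed.

Lemma mod2_0 : mod2 (0 : lattice g) = 0.
Proof. by apply/matrixP=> i j; rewrite !mxE. Qed.

Lemma mod2_double z : mod2 (z *+ 2) = 0.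
Proof. by rewrite mulr2n mod2D addrr_F2. Qed.

Lemma dot_mod2 (u x : lattice g) : dot (mod2 u) (mod2 x) = (dot u x)%:~R.
Proof.
by rewrite !dotE rmorph_sum; apply: eq_bigr => i _; rewrite !mxE rmorphM.
Qed.

End Mod2.

Section Parity.
Variable R : realType.

Definition parity (t : 'F_2) : R := (t : nat)%:R.

Lemma parity_itv (t : 'F_2) : 0 <= parity t <= 1.
Proof. by case: (F2_eq0_or_eq1 t) => ->; rewrite /parity /= ?lexx ler01. Qed.

Lemma parity_le_sqr (k : int) : parity k%:~R <= k%:~R ^+ 2.
Proof.
have [->|k0] := eqVneq k 0; first by rewrite /parity expr0n.
have /andP[_ /le_trans] := parity_itv k%:~R; apply.
rewrite -rmorphXn -[1]/(1%:~R) ler_int; nia.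
Qed.

Lemma parity_eq_sqr (k : int) : `|k| <= 1 -> parity k%:~R = k%:~R ^+ 2.
Proof.
move=> k1; have : k \in [:: 0; 1; -1] by rewrite !inE; lia.
rewrite !inE => /or3P[] /eqP ->; rewrite /parity.
- by rewrite expr0n.
- by rewrite expr1n.
- by rewrite mulrN1z sqrrN expr1n.
Qed.

Lemma sign_parity (t : 'F_2) : (-1) ^+ t = 1 - 2 * parity t :> R.
Proof.
by rewrite /parity; case: (F2_eq0_or_eq1 t) => ->; rewrite ?mulr0 ?mulr1 /=;
  ring.
Qed.

Lemma sign_F2D (s t : 'F_2) : (-1) ^+ (s + t)%R = (-1) ^+ s * (-1) ^+ t :> R.
Proof.
by case: (F2_eq0_or_eq1 s) => ->; case: (F2_eq0_or_eq1 t) => ->;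
  rewrite /=; ring.
Qed.

(** The left side counts which of r, r + p, r + s, r + p + s are 1: exactly two
    of them unless p = s = 0, when it is all or none.  Dually the sum of the
    parities of p, s and p + s is 2 unless p = s = 0. *)
Lemma parity_half_sum (p s r : 'F_2) :
  parity r + parity (r + p) + parity (r + s) + parity (r + (p + s)) =
  parity p + parity s + parity (p + s)
    + 4 * (parity r * (1 - parity p) * (1 - parity s)).
Proof.
have [p0 p1] : parity 0 = 0 /\ parity 1 = 1 by [].
by case: (F2_eq0_or_eq1 p) => ->; case: (F2_eq0_or_eq1 s) => ->;
  case: (F2_eq0_or_eq1 r) => ->; rewrite ?(addr0, add0r, addF2_11) ?(p0, p1);
  ring.
Qed.

End Parity.

(** * Fourier duality between vonorms and conorms *)

Section Fourier.
Variables (R : realType) (g : nat).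
Implicit Types (u a : lattice_mod2 g) (Q : 'rV[R]_g -> R).

(** Orthogonality of characters: if u(b) = 1 for some b, translation by b
    changes the sign of every term. *)
Lemma sum_sign_dot u : \sum_a (-1) ^+ (dot u a) = (u == 0)%:R * 2 ^+ g :> R.
Proof.
have [->|] := eqVneq u 0.
  under eq_bigr do rewrite dotC dot0r expr0.
  by rewrite sumr_const card_mx card_Fp // mul1n mul1r natrX.
case/rV0Pn=> i ui; have di : dot u (delta_mx 0 i) = 1.
  by rewrite dot_delta; case: (F2_eq0_or_eq1 (u 0 i)) ui => ->.
rewrite mul0r; set S := LHS; suff: S = - S by move: S => S e; lra.
rewrite /S [LHS](reindex_inj (addIr (delta_mx 0 i))) -sumrN.
by apply: eq_bigr => a _; rewrite dotDr di sign_F2D [X in _ * X]expr1 mulrN1.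
Qed.

Lemma conorm_dot_form Q u :
  conorm Q (dot_form u) =
  - (2 / 2 ^+ g * \sum_a (-1) ^+ (dot u a) * vonorm Q a).
Proof.
have e2 : (2 : R) ^ (1 - g%:Z) = 2 / 2 ^+ g.
  by rewrite expfzDr ?pnatr_eq0 // exprnN.
rewrite /conorm e2 mulNr; congr (- (_ * _)).
by apply: eq_bigr => a _; rewrite dot_formE.
Qed.

Lemma vonorm_of_conorms Q a : vonorm Q 0 = 0 ->
  vonorm Q a = \sum_u conorm Q (dot_form u) * parity R (dot u a).
Proof.
move=> Q0; have g2 : (2 : R) ^+ g != 0 by rewrite expf_neq0 ?pnatr_eq0.
pose S b := \sum_(u : lattice_mod2 g) (-1) ^+ (dot u b) : R.
have SE b : S b = (b == 0)%:R * 2 ^+ g.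
  by rewrite -sum_sign_dot; apply: eq_bigr => u _; rewrite dotC.
(* The parity of u(a) is (1 - (-1) ^ u(a)) / 2, so after exchanging the sums
   the coefficient of vonorm Q b is proportional to S b - S (a + b). *)
transitivity (- 1 / 2 ^+ g *
    \sum_(b : lattice_mod2 g) (S b - S (a + b)) * vonorm Q b).
  rewrite (bigD1 a) //= big1 ?addr0 => [|b ba]; last first.
    have [->|b0] := eqVneq b 0; first by rewrite Q0 mulr0.
    have ab : (a + b == 0) = false.
      by rewrite addrC -[a]oppr_F2 subr_eq0 (negbTE ba).
    by rewrite !SE (negbTE b0) ab mul0r subrr mul0r.
  rewrite !SE addrr_F2 eqxx; have [->|_] := eqVneq a 0.
    by rewrite Q0 !mulr0.
  by rewrite /=; field.
rewrite mulr_sumr; under eq_bigr => b _ do rewrite -sumrB mulr_suml mulr_sumr.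
rewrite exchange_big; apply: eq_bigr => u _ /=.
rewrite conorm_dot_form -mulNr -mulrA mulr_suml mulr_sumr.
by apply: eq_bigr => b _; rewrite dotDr sign_F2D !sign_parity; field.
Qed.

Lemma conorm_of_cuts (E : finType) Q (l : E -> R) (w : E -> lattice_mod2 g) u :
  (forall a, vonorm Q a = \sum_k l k * parity R (dot (w k) a)) -> u != 0 ->
  conorm Q (dot_form u) = \sum_(k | w k == u) l k.
Proof.
move=> vE u0; have g2 : (2 : R) ^+ g != 0 by rewrite expf_neq0 ?pnatr_eq0.
rewrite conorm_dot_form -mulNr; under eq_bigr => a _ do rewrite vE mulr_sumr.
rewrite exchange_big /= mulr_sumr [RHS]big_mkcond; apply: eq_bigr => k _.
transitivity (l k * (- 1 / 2 ^+ g) *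
   (\sum_a (-1) ^+ (dot u a) - \sum_a (-1) ^+ (dot (w k + u) a))).
  rewrite -sumrB !mulr_sumr; apply: eq_bigr => a _.
  by rewrite dotDl sign_F2D !sign_parity; field.
rewrite !sum_sign_dot (negbTE u0) -(oppr_F2 u) subr_eq0 oppr_F2.
by case: eqVneq => _ /=; field.
Qed.

End Fourier.

(** * Integral points of unimodular systems *)

Section Realify.
Context {R : realType} {g : nat}.
Implicit Types x y : lattice g.

Lemma realifyD x y : realify R (x + y) = realify R x + realify R y.
Proof. exact: map_mxD. Qed.

Lemma realifyB x y : realify R (x - y) = realify R x - realify R y.
Proof. exact: map_mxB. Qed.

Lemma realifyM n (c : 'rV[int]_n) (M : 'M[int]_(n, g)) :
  realify R (c *m M) = realify R c *m map_mx intr M.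
Proof. exact: map_mxM. Qed.

Lemma realify_eq0 x : realify R x = 0 -> x = 0.
Proof.
move=> /rowP x0; apply/rowP=> i; have := x0 i.
by rewrite !mxE => /eqP; rewrite intr_eq0 => /eqP.
Qed.

Lemma dot_realify (u x : lattice g) :
  dot (realify R u) (realify R x) = (dot u x)%:~R.
Proof.
by rewrite !dotE rmorph_sum; apply: eq_bigr => i _; rewrite !mxE rmorphM.
Qed.

Lemma realify_dualE (a : lattice_dual g) (x : 'rV[R]_g) :
  realify_dual a x = dot (realify R (coefs a)) x.
Proof. by rewrite dotE; apply: eq_bigr => i _; rewrite !mxE mulrC. Qed.

Lemma realify_dual_int (a : lattice_dual g) x :
  realify_dual a (realify R x) = (a x : int)%:~R.
Proof. by rewrite realify_dualE dot_realify -coefsE. Qed.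

End Realify.

(** A change of integral basis multiplies all the minors by the same sign. *)
Lemma unimodular_coefs (g : nat) (E : finType) (a : E -> lattice_dual g) :
  unimodular_family a <->
  forall f : 'I_g -> E, \det (\matrix_j coefs (a (f j))) \in [:: 0; 1; -1].
Proof.
have dE P (f : 'I_g -> E) : \matrix_(i, j) (a (f j) (row i P) : int) =
    P *m (\matrix_j coefs (a (f j)))^T.
  apply/matrixP=> i j; rewrite !mxE coefsE dotC dotE.
  by apply: eq_bigr => k _; rewrite !mxE.
split=> [[P uP det1] f|det1]; last first.
  by exists 1%:M; [exact: unitmx1|move=> f; rewrite dE mul1mx det_tr].
have /orP[/eqP eP|/eqP eP] : (\det P == 1) || (\det P == -1).
- by rewrite unitmxE in uP.
- by have := det1 f; rewrite dE det_mulmx det_tr eP mul1r.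
have := det1 f; rewrite dE det_mulmx det_tr eP mulN1r !inE.
by rewrite oppr_eq0 !eqr_oppLR opprK => /or3P[] ->; rewrite ?orbT.
Qed.

Section Integrality.
Context {R : realType} {g : nat} {E : finType}.
Variable w : E -> lattice g.
Hypothesis w_det :
  forall f : 'I_g -> E, \det (\matrix_j w (f j)) \in [:: 0; 1; -1].
Hypothesis w_separating :
  forall v : 'rV[R]_g, (forall e, dot (realify R (w e)) v = 0) -> v = 0.

(** A point z of the box moves along a direction on which all the tight forms
    (those at one of their bounds) vanish, until another form becomes tight.
    Once the tight forms separate points, g of them form an integral matrix of
    determinant 1 or -1, and z solves an integral system with that matrix. *)
Lemma unimodular_integral_point (l u : E -> int) (z : 'rV[R]_g) :
  (forall e, (l e)%:~R <= dot (realify R (w e)) z <= (u e)%:~R) ->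
  exists y : lattice g, forall e, l e <= dot (w e) y <= u e.
Proof.
pose A e (z : 'rV[R]_g) := dot (realify R (w e)) z.
pose tight z := [pred e | (A e z == (l e)%:~R) || (A e z == (u e)%:~R)].
have [n] := ubnP #|[predC tight z]|; elim: n => // n IHn in z * => ltn box.
have [sep|] := pselect (forall v, (forall e, tight z e -> A e v = 0) -> v = 0).
  have [f ft uf] := basis_of_separating sep.
  pose M := \matrix_j w (f j).
  have MR : \matrix_j realify R (w (f j)) = map_mx intr M.
    by apply/matrixP=> i j; rewrite !mxE.
  have uM : M \in unitmx.
    move: uf (w_det f); rewrite -/M MR !unitmxE det_map_mx unitfE intr_eq0.
    by rewrite !inE => /negbTE -> /= /orP[] /eqP ->.
  pose c := \row_j (if A (f j) z == (l (f j))%:~R then l (f j) else u (f j)).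
  have zM : z *m (map_mx intr M)^T = realify R c.
    apply/rowP=> j; rewrite !mxE; transitivity (A (f j) z).
      by rewrite /A dotC dotE; apply: eq_bigr => i _; rewrite !mxE.
    by case/orP: (ft j) => /eqP ->; rewrite ?eqxx //; case: eqP => // ->.
  pose y := c *m invmx M^T.
  have zy : z = realify R y.
    have uMR : (map_mx intr M : 'M[R]_g)^T \in unitmx by rewrite -MR unitmx_tr.
    apply: (can_inj (mulmxK uMR)); rewrite zM map_trmx -realifyM.
    by rewrite mulmxKV // unitmx_tr.
  by exists y => e; move: (box e); rewrite zy dot_realify !ler_int.
move/existsNP=> [v /not_implyP[vt /eqP v0]].
have [e0 ve0] : exists e, A e v != 0.
  apply: contrapT => nex; case/eqP: v0; apply: w_separating => e.
  by apply: contrapT => /eqP ne; apply: nex; exists e.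
(* t e is the time at which e reaches the bound towards which v moves it. *)
pose t e :=
  (if 0 < A e v then (u e)%:~R - A e z else (l e)%:~R - A e z) / A e v.
case: (arg_minP (P := fun e => A e v != 0) t ve0) => e ve tmin.
pose z' := z + t e *: v.
have Az' k : A k z' = A k z + t e * A k v by rewrite /A dotDr dotZr.
have tM k : A k v != 0 -> t k * A k v =
    (if 0 < A k v then (u k)%:~R - A k z else (l k)%:~R - A k z).
  by move=> vk; rewrite /t divfK.
have te0 : 0 <= t e.
  have := tM e ve; move: ve (box e); rewrite -/(A e z).
  by case: ltgtP => // sv _ /andP[lk uk] te; nra.
have box' k : (l k)%:~R <= A k z' <= (u k)%:~R.
  rewrite Az'; have [->|vk] := eqVneq (A k v) 0.
    by rewrite mulr0 addr0 box.
  have tk := tM k vk; have tek := tmin k vk.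
  move: vk tk (box k); rewrite -/(A k z).
  by case: ltgtP => // sv _ tk /andP[lk uk]; apply/andP; split; nra.
apply: (IHn z') box'; rewrite -ltnS; apply: leq_trans ltn; rewrite ltnS.
apply: proper_card; apply/properP; split.
  apply/fintype.subsetP=> k; rewrite !inE; apply: contra => tk.
  by rewrite Az' vt // mulr0 addr0.
exists e; rewrite !inE; first by apply: contraNN ve => /vt ->.
by rewrite negbK Az' tM //; case: ifP => _; rewrite addrC subrK eqxx ?orbT.
Qed.

End Integrality.

(** * Matroidal forms have nonnegative conorms *)

Section MatroidalToConorms.
Context {R : realType} {g : nat} {E : finType}.
Variables (a : E -> lattice_dual g) (lam : E -> R) (Q : 'rV[R]_g -> R).
Hypothesis a_unimod : unimodular_family a.
Hypothesis lam_gt0 : forall e, 0 < lam e.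
Hypothesis QE : forall x, Q x = \sum_e lam e * realify_dual (a e) x ^+ 2.
Hypothesis Qpos : positive_definite Q.

Lemma matroidal_separating (v : 'rV[R]_g) :
  (forall e, dot (realify R (coefs (a e))) v = 0) -> v = 0.
Proof.
move=> av; have [//|/(proj2 Qpos)] := eqVneq v 0.
by rewrite QE big1 ?ltxx // => e _; rewrite realify_dualE av expr0n mulr0.
Qed.

(** An integral point z between the two roundings of x / 2, for all the forms
    at once, gives x - 2 z. *)
Lemma unimodular_small_representative (x : lattice g) :
  exists2 y : lattice g, mod2 y = mod2 x & forall e, `|(a e y : int)| <= 1.
Proof.
pose b e : int := a e x.
have [|z zP] := @unimodular_integral_point R g E (fun e => coefs (a e))
    ((unimodular_coefs a).1 a_unimod) matroidal_separating
    (fun e => (b e %/ 2)%Z) (fun e => ((b e + 1) %/ 2)%Z) (2^-1 *: realify R x).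
  move=> e; rewrite dotZr dot_realify -coefsE -/(b e).
  rewrite ler_pdivlMl ?ler_pdivrMl // -!(intrM _ 2) !ler_int; lia.
exists (x - z *+ 2); first by rewrite mod2B mod2_double addr0.
move=> e; have := zP e; rewrite -coefsE.
have -> : (a e (x - z *+ 2) : int) = b e - (a e z : int) * 2.
  by rewrite raddfB raddfMn /= mulr_natr.
move: (b e) (a e z : int) => k m; lia.
Qed.

Lemma vonorm_matroidal (alpha : lattice_mod2 g) :
  vonorm Q alpha = \sum_e lam e * parity R (dot (mod2 (coefs (a e))) alpha).
Proof.
have [x xa [vx vmin]] := vonorm_min alpha Qpos.
have [y yx y1] := unimodular_small_representative x.
have parityE e z : mod2 z = alpha ->
    dot (mod2 (coefs (a e))) alpha = (a e z : int)%:~R.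
  by move=> <-; rewrite dot_mod2 -coefsE.
apply/eqP; rewrite eq_le; apply/andP; split.
  rewrite (le_trans (vmin y _)) ?yx // QE; apply: ler_sum => e _.
  by rewrite (parityE e y) ?yx // realify_dual_int parity_eq_sqr.
rewrite vx QE; apply: ler_sum => e _.
by rewrite (parityE e x) // realify_dual_int ler_pM2l // parity_le_sqr.
Qed.

Lemma matroidal_conorm_ge0 (e : lattice_mod2_dual g) :
  e != 0 -> 0 <= conorm Q e.
Proof.
rewrite -(coefsK e) dot_form_eq0 => u0.
rewrite (conorm_of_cuts vonorm_matroidal u0).
by apply: sumr_ge0 => k _; apply: ltW.
Qed.

End MatroidalToConorms.

(** * Minimal vectors *)

Lemma abszB_disjoint (a b : int) :
  (`|a| == 0)%N || (`|b| == 0)%N -> `|(a - b)%R|%N = (`|a| + `|b|)%N.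
Proof. lia. Qed.

Lemma absz1_mem (a : int) : `|a|%N = 1%N -> a \in [:: 0; 1; -1].
Proof. rewrite !inE; lia. Qed.

Section ConormsToMatroidal.
Context {R : realType} {g : nat}.
Variables (Q : 'rV[R]_g -> R) (B : {symmetric 'rV[R]_g}).
Variable lam : lattice_mod2 g -> R.
Hypothesis Qpos : positive_definite Q.
Hypothesis QB : forall x, Q x = B x x.
Hypothesis lam_ge0 : forall u, 0 <= lam u.
Hypothesis lam0 : lam 0 = 0.
Hypothesis vonormE : forall a,
  vonorm Q a = \sum_(u : lattice_mod2 g) lam u * parity R (dot u a).

Local Notation q x := (Q (realify R x)).

Lemma polar_sym x y : B x y = B y x.
Proof. by rewrite hermC expr0 mul1r. Qed.

Lemma quadratic0 : Q 0 = 0.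
Proof. by rewrite QB linear0l. Qed.

Lemma quadratic_ge0 x : 0 <= Q x.
Proof.
by have [->|/(proj2 Qpos)/ltW//] := eqVneq x 0; rewrite quadratic0.
Qed.

Lemma quadratic_lattice_eq0 (x : lattice g) : q x = 0 -> x = 0.
Proof.
move=> qx; apply: (@realify_eq0 R); apply: contra_eq qx => /(proj2 Qpos).
by rewrite lt0r => /andP[].
Qed.

Lemma parallelogram (x y : 'rV[R]_g) : Q (x + y) + Q (x - y) = 2 * (Q x + Q y).
Proof.
rewrite !QB linearBl !linearBr linearDl !linearDr /= (polar_sym y x).
by ring.
Qed.

Definition minimal (x : lattice g) := q x = vonorm Q (mod2 x).

Lemma vonorm_le (x : lattice g) : vonorm Q (mod2 x) <= q x.
Proof. by have [y _ [_ /(_ x erefl)]] := vonorm_min (mod2 x) Qpos. Qed.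

Lemma minimal_exists (a : lattice_mod2 g) :
  exists2 x : lattice g, minimal x & mod2 x = a.
Proof.
by have [x xa [vx _]] := vonorm_min a Qpos; exists x; rewrite /minimal ?xa.
Qed.

Lemma minimal_eq0 (x : lattice g) : minimal x -> mod2 x = 0 -> x = 0.
Proof.
rewrite /minimal => mx x0; apply: quadratic_lattice_eq0.
by rewrite mx x0 vonormE big1 // => u _; rewrite dot0r mulr0.
Qed.

Lemma vonorm_gt0 (a : lattice_mod2 g) : a != 0 -> 0 < vonorm Q a.
Proof.
have [x mx <-] := minimal_exists a => x0; rewrite -mx; apply: (proj2 Qpos).
by apply: contraNneq x0 => /realify_eq0 ->; rewrite mod2_0.
Qed.

Lemma support_separates (a : lattice_mod2 g) :
  (forall u, 0 < lam u -> dot u a = 0) -> a = 0.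
Proof.
move=> ua; have [//|/vonorm_gt0] := eqVneq a 0.
rewrite vonormE big1 ?ltxx // => u _; have := lam_ge0 u.
rewrite le_eqVlt => /orP[/eqP<-|/ua ->]; first by rewrite mul0r.
by rewrite /parity mulr0.
Qed.

Lemma quadratic_half_sum (x y z w : lattice g) : x + y + z = w *+ 2 ->
  q w + q (w - x) + q (w - y) + q (w - z) = q x + q y + q z.
Proof.
move=> /(canRL (addKr _)) ->; rewrite mulr2n !(realifyB, realifyD).
have -> : realify R (- (x + y)) = - realify R x - realify R y.
  by apply/rowP=> i; rewrite !mxE opprD intrD !mulrNz.
move: (realify R x) (realify R y) (realify R w) => X Y W.
rewrite (_ : W - (- X - Y + (W + W)) = X + Y - W); last first.
  by rewrite !opprD !opprK addrCA [W + _]addrA subrr add0r.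
rewrite (_ : - X - Y + (W + W) = W + W - X - Y); last by rewrite addrC addrA.
rewrite !QB.
do ![rewrite !(linearBl, linearDl) | rewrite !(linearBr, linearDr)].
by rewrite /= (polar_sym Y X) (polar_sym W X) (polar_sym W Y); ring.
Qed.

(** By [quadratic_half_sum] and [parity_half_sum], the excess of q over the
    vonorm for the vectors w, w - x, w - y, w - z, plus four times the weight
    of the cuts containing w but neither x nor y, add up to 0; all these
    quantities are nonnegative. *)
Lemma minimal_half_sum (x y z w : lattice g) :
  minimal x -> minimal y -> minimal z -> x + y + z = w *+ 2 ->
  [/\ minimal w, minimal (w - y) &
      forall u, 0 < lam u -> dot u (mod2 x) = 0 -> dot u (mod2 y) = 0 ->
        dot u (mod2 w) = 0].
Proof.
move=> mx my mz xyz; have qs := quadratic_half_sum xyz.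
have ez : mod2 z = mod2 x + mod2 y.
  have := congr1 (@mod2 g) xyz; rewrite mod2_double !mod2D => /eqP.
  by rewrite addr_eq0 oppr_F2 => /eqP.
pose D u := parity R (dot u (mod2 w)) * (1 - parity R (dot u (mod2 x))) *
  (1 - parity R (dot u (mod2 y))).
have D_ge0 u : 0 <= D u.
  have /andP[? _] := parity_itv R (dot u (mod2 w)).
  have /andP[_ ?] := parity_itv R (dot u (mod2 x)).
  have /andP[_ ?] := parity_itv R (dot u (mod2 y)).
  by rewrite !mulr_ge0 ?subr_ge0.
have vs : vonorm Q (mod2 w) + vonorm Q (mod2 (w - x)) +
    vonorm Q (mod2 (w - y)) + vonorm Q (mod2 (w - z)) =
    vonorm Q (mod2 x) + vonorm Q (mod2 y) + vonorm Q (mod2 z) +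
    4 * \sum_u lam u * D u.
  rewrite !vonormE mulr_sumr -!big_split; apply: eq_bigr => u _ /=.
  rewrite !mod2B ez !dotDr -!mulrDr parity_half_sum.
  by rewrite [LHS]mulrDr [X in _ + X]mulrCA.
have S0 : 0 <= \sum_u lam u * D u by apply: sumr_ge0 => u _; rewrite mulr_ge0.
move: mx my mz; rewrite /minimal => mx my mz.
have := (vonorm_le w, vonorm_le (w - x), vonorm_le (w - y), vonorm_le (w - z)).
case=> -[[h1 h2] h3] h4; split; [lra|lra|].
have {}S0 : \sum_u lam u * D u = 0 by lra.
move=> u lu ux uy; have lD_ge0 v := mulr_ge0 (lam_ge0 v) (D_ge0 v).
have /eqP := @psumr_eq0P _ _ xpredT _ (fun v _ => lD_ge0 v) S0 u isT.
rewrite mulf_eq0 gt_eqF //= /D ux uy /parity subr0 !mulr1 pnatr_eq0.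
by case: (F2_eq0_or_eq1 (dot u (mod2 w))) => ->.
Qed.

(** * The lattice basis attached to a basis of the support *)

Section Basis.
Variable u : 'I_g -> lattice_mod2 g.
Hypothesis lam_u : forall j, 0 < lam (u j).
Hypothesis u_unit : \matrix_j u j \in unitmx.

Lemma basis_separates a : (forall i, dot (u i) a = 0) -> a = 0.
Proof. by move=> ua; apply: (dot_matrix_unit u_unit) => i; rewrite rowK. Qed.

Lemma dual_minimal : exists X : 'I_g -> lattice g,
  (forall j, minimal (X j)) /\ forall i j, dot (u i) (mod2 (X j)) = (i == j)%:R.
Proof.
pose a j := row j (invmx (\matrix_j u j))^T.
have /fin_all_exists[X XP] j : exists x, minimal x /\ mod2 x = a j.
  by have [x mx xa] := minimal_exists (a j); exists x.
exists X; split=> [j|i j]; first by have [] := XP j.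
have [_ ->] := XP j.
have <- : (1%:M : 'M['F_2]_g) i j = (i == j)%:R by rewrite mxE.
by rewrite -(mulmxV u_unit) mxE dotE; apply: eq_bigr => k _; rewrite !mxE.
Qed.

Variable X : 'I_g -> lattice g.
Hypothesis X_min : forall j, minimal (X j).
Hypothesis X_dual : forall i j, dot (u i) (mod2 (X j)) = (i == j)%:R.

Local Notation d i z := (dot (u i) (mod2 z)).
Local Notation XM := (\matrix_j X j).

Local Notation sign_coords z := (exists2 c : 'rV[int]_g,
  z = c *m XM & forall i, `|c 0%R i|%N = d i z :> nat).

(** Induction on the number of odd d k z.  With d i z = 1, let v be minimal in
    the class of z + X i, and X i + z + v = 2 w.  The d k w are odd only where
    the d k z are.  If they vanish for all k, or agree with the d k z for all
    k, then w = 0 or w = z, that is z = - (X i + v) or z = X i + v, and v has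
    one odd coordinate fewer than z.  Otherwise z = w - (w - z), where w and
    w - z are minimal with disjoint smaller sets of odd coordinates. *)
Lemma minimal_coords z : minimal z -> sign_coords z.
Proof.
have [n] := ubnP #|[pred i | d i z != 0]|.
elim: n => // n IHn in z * => ltn mz.
have fewer y : (forall k, d k z = 0 -> d k y = 0) ->
    (exists2 k, d k z != 0 & d k y = 0) -> (#|[pred i | d i y != 0%R]| < n)%N.
  move=> yz [k zk yk]; rewrite -ltnS; apply: leq_trans ltn; rewrite ltnS.
  apply/proper_card/properP; split.
    by apply/fintype.subsetP=> j; rewrite !inE; apply: contraNN => /eqP/yz ->.
  by exists k; rewrite !inE // yk eqxx.
have [i di|z0] := pickP (fun i => d i z != 0); last first.
  have -> : z = 0.
    apply: minimal_eq0 mz _; apply: basis_separates => i; apply/eqP.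
    by rewrite -[_ == _]negbK z0.
  by exists 0; rewrite ?mul0mx // => i; rewrite mod2_0 dot0r mxE.
have d1 k y : d k y != 0 -> d k y = 1.
  by case: (F2_eq0_or_eq1 (d k y)) => ->.
have [v mv vE] := minimal_exists (mod2 z + mod2 (X i)).
have /mod2_eq[w] : mod2 (X i + z + v) = mod2 0.
  by rewrite !mod2D vE mod2_0 [mod2 (X i) + _]addrC addrr_F2.
rewrite subr0 => wE.
have [mw mwz uw] := minimal_half_sum (X_min i) mz mv wE.
have wz k : d k z = 0 -> d k w = 0.
  move=> zk; apply: uw; rewrite // X_dual; case: eqP => // ki.
  by rewrite -ki zk in di.
have dv k : d k v = d k z + (k == i)%:R by rewrite vE dotDr X_dual.
have dvi : d i v = 0 by rewrite dv eqxx d1 // addF2_11.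
have [c vc cv] : sign_coords v.
  apply: IHn mv; apply: fewer; last by exists i.
  move=> k zk; rewrite dv zk; have [ki|_] := eqVneq k i; last by rewrite addr0.
  by rewrite -ki zk eqxx in di.
have [c' c'E c'P] : exists2 c : 'rV[int]_g, X i + v = c *m XM &
    forall i, `|c 0%R i|%N = d i z :> nat.
  exists (delta_mx 0 i + c); first by rewrite mulmxDl -vc -rowE rowK.
  move=> k; rewrite mxE [delta_mx _ _ _ _]mxE /=.
  have [->|ki] := eqVneq k i.
    by move: (cv i); rewrite dvi d1 //= => /eqP; rewrite absz_eq0 => /eqP ->.
  by rewrite add0r cv dv (negbTE ki) addr0.
have [dw|/existsNP[k1 wk1]] := pselect (forall k, d k w = 0).
  have w0 : w = 0 by apply: minimal_eq0 mw _; apply: basis_separates.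
  exists (- c') => [|k]; last by rewrite mxE abszN.
  by apply/eqP; rewrite mulNmx -c'E -addr_eq0 addrA [z + _]addrC wE w0 mul0rn.
have [dwz0|/existsNP[k2 wk2]] := pselect (forall k, d k (w - z) = 0).
  have wz0 : w - z = 0 by apply: minimal_eq0 mwz _; apply: basis_separates.
  exists c' => //; rewrite -c'E; apply: (addIr z).
  rewrite -mulr2n addrAC wE; congr (_ *+ 2).
  by apply/esym/eqP; rewrite -subr_eq0 wz0.
have dwz k : d k (w - z) = d k w + d k z by rewrite mod2B dotDr.
have zk1 : d k1 z != 0 by apply: contra_notN wk1 => /eqP/wz.
have zk2 : d k2 z != 0.
  by apply: contra_notN wk2 => /eqP zk; rewrite dwz zk wz // addr0.
have [c1 e1 c1P] : sign_coords w.
  apply: IHn mw; apply: fewer => //; exists k2 => //.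
  move: wk2; rewrite dwz (d1 _ _ zk2).
  by case: (F2_eq0_or_eq1 (d k2 w)) => -> // []; exact: addF2_11.
have [c2 e2 c2P] : sign_coords (w - z).
  apply: IHn mwz; apply: fewer => [k zk|]; first by rewrite dwz zk wz // addr0.
  exists k1 => //; rewrite dwz (d1 _ _ zk1).
  by move: wk1; case: (F2_eq0_or_eq1 (d k1 w)) => -> // _; exact: addF2_11.
exists (c1 - c2); first by rewrite mulmxBl -e1 -e2 subKr.
move=> k; have := c1P k; have := c2P k; rewrite dwz 2!mxE.
have [n0 n1] : (0 : 'F_2) = 0%N :> nat /\ (1 : 'F_2) = 1%N :> nat by [].
have := wz k; case: (F2_eq0_or_eq1 (d k z)) => ->.
  by move=> -> //; rewrite addr0 !n0 => c2k c1k; rewrite abszB_disjoint c1k c2k.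
case: (F2_eq0_or_eq1 (d k w)) => -> _;
  rewrite ?(add0r, addF2_11) !(n0, n1) => c2k c1k;
  by rewrite abszB_disjoint c1k c2k.
Qed.

(** Outside 2 L the least vonorm of a nonzero class is a bound, and Q only grows
    under doubling. *)
Lemma quadratic_lattice_bound :
  exists2 c : R, 0 < c & forall y : lattice g, y != 0 -> c <= q y.
Proof.
pose c := \big[Num.min/1]_(a : lattice_mod2 g | a != 0) vonorm Q a; exists c.
  rewrite /c; elim/big_ind: _ => // [s t s0 t0|a /vonorm_gt0//].
  by rewrite lt_min s0 t0.
move=> y; have [n] := ubnP (\sum_i `|y 0%R i|%N).
elim: n => // n IHn in y * => yn y0.
have [y2|y2] := eqVneq (mod2 y) 0; last first.
  by apply: le_trans (vonorm_le y); apply: bigmin_le_cond.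
have /mod2_eq[z] : mod2 y = mod2 0 by rewrite y2 mod2_0.
rewrite subr0 => yz.
have z0 : z != 0 by apply: contraNneq y0 => z0; rewrite yz z0 mul0rn.
have qz : c <= q z.
  apply: (IHn _ _ z0); move: yn; rewrite yz.
  under eq_bigr => i _ do rewrite mulr2n mxE -mulr2n -mulr_natr abszM.
  have [i zi] := rV0Pn _ z0.
  rewrite -big_distrl /= (bigD1 i) //=; move: (\sum_(j | _) _)%N => m.
  have : (0 < `|z 0%R i|)%N by rewrite absz_gt0.
  lia.
have := parallelogram (realify R z) (realify R z).
rewrite -realifyD -mulr2n -yz subrr quadratic0 addr0 => ->.
by have := quadratic_ge0 (realify R z); lra.
Qed.

(** Descent: if y0 is minimal in the class of y, then s = (y - y0) / 2 and
    t = (y + y0) / 2 satisfy q s + q t <= q y, so one of them has at most half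
    the length of y, and y is 2 s + y0 and 2 t - y0. *)
Lemma basis_generates y : exists c : 'rV[int]_g, y = c *m XM.
Proof.
have [e e0 eP] := quadratic_lattice_bound.
suff gen n : forall y, q y < 2 ^+ n * e -> exists c : 'rV[int]_g, y = c *m XM.
  apply: (gen (Num.bound (q y / e))); rewrite -ltr_pdivrMr //.
  apply: lt_trans (archi_boundP _) _.
    by rewrite divr_ge0 ?quadratic_ge0 // ltW.
  by rewrite -natrX ltr_nat ltn_expl.
elim: n => [|n IHn] {}y yn.
  exists 0; rewrite mul0mx; apply: contraTeq yn => /eP.
  by rewrite expr0 mul1r -leNgt.
have [y0 my0 yy0] := minimal_exists (mod2 y).
have [c0 y0E _] := minimal_coords my0.
have /mod2_eq[s yE] := esym yy0.
have {}yE : y = y0 + s *+ 2 by rewrite -yE addrC subrK.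
pose t := s + y0.
have st : 2 * (q s + q t) <= 2 * q y.
  have := parallelogram (realify R t) (realify R s).
  rewrite -realifyD -realifyB.
  have -> : t + s = y by rewrite /t yE mulr2n addrAC addrC.
  have -> : t - s = y0 by rewrite /t addrAC subrr add0r.
  by have := vonorm_le y; rewrite -yy0 -my0; lra.
have e2 : 2 ^+ n.+1 * e = 2 * (2 ^+ n * e) by rewrite exprS mulrA.
have [sn|sn] := ltP (q s) (2 ^+ n * e).
  have [c cE] := IHn _ sn; exists (c0 + c *+ 2).
  by rewrite yE y0E {1}cE mulmxDl mulr2n [c *+ 2]mulr2n mulmxDl.
have tn : q t < 2 ^+ n * e by lra.
have [c cE] := IHn _ tn; exists (c *+ 2 - c0).
rewrite mulmxBl [c *+ 2]mulr2n mulmxDl -cE -y0E /t yE mulr2n.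
by rewrite addrACA addrA addrK addrC.
Qed.

Lemma basis_left_inverse : exists C : 'M[int]_g, C *m XM = 1%:M.
Proof.
have /fin_all_exists[c cP] i := basis_generates (delta_mx 0 i).
exists (\matrix_i c i).
by apply/row_matrixP=> i; rewrite row_mul rowK -cP row1.
Qed.

Lemma basis_coordinate k : exists w : lattice g, forall z, minimal z ->
  `|dot w z|%N = d k z :> nat.
Proof.
have [C CX] := basis_left_inverse.
exists (col k C)^T => z /minimal_coords[b -> /(_ k) <-].
rewrite dotC /dot trmxK colE -mulmxA (mulmxA XM) (mulmx1C CX) mul1mx.
by rewrite -colE mxE.
Qed.

End Basis.

(** * Lifting the support to a unimodular family *)

(** Steinitz exchange in any basis inside the support. *)
Lemma basis_through (e : lattice_mod2 g) : 0 < lam e ->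
  exists u : 'I_g -> lattice_mod2 g, [/\ forall j, 0 < lam (u j),
    \matrix_j u j \in unitmx & exists k, u k = e].
Proof.
move=> le; have [u lu uu] := basis_of_separating support_separates.
pose c := e *m invmx (\matrix_j u j).
have ce : e = c *m \matrix_j u j by rewrite mulmxKV.
have /rV0Pn[k ck] : c != 0.
  by apply: contraTneq le => c0; rewrite ce c0 mul0mx lam0 ltxx.
exists (fun j => if j == k then e else u j); split.
- by move=> j; case: eqP.
- apply: separating_unit => a ua; apply: (basis_separates uu) => i.
  have uj j : j != k -> dot (u j) a = 0.
    by move=> jk; have := ua j; rewrite (negbTE jk).
  have [->|/uj//] := eqVneq i k.
  have uE j : (\matrix_j u j *m a^T) j 0 = dot (u j) a.
    by rewrite /dot -[in RHS](rowK u j) -row_mul [RHS]mxE.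
  have := ua k; rewrite eqxx ce /dot -mulmxA mxE (bigD1 k) //= big1 ?addr0.
    by move/eqP; rewrite mulf_eq0 (negbTE ck) uE => /eqP.
  by move=> j jk; rewrite uE uj // mulr0.
- by exists k; rewrite eqxx.
Qed.

Lemma support_lift (e : lattice_mod2 g) : 0 < lam e ->
  exists w : lattice g, forall z, minimal z ->
    `|dot w z|%N = dot e (mod2 z) :> nat.
Proof.
case/basis_through=> u [lu uu [k <-]].
have [X [X_min X_dual]] := dual_minimal uu.
exact: (basis_coordinate lu uu X_min X_dual).
Qed.

Section Lifts.
Variables (E : finType) (f : E -> lattice_mod2 g) (w : E -> lattice g).
Hypothesis w_lift : forall e z, minimal z ->
  `|dot (w e) z|%N = dot (f e) (mod2 z) :> nat.

Lemma lifts_unimodular (k : 'I_g -> E) :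
  \det (\matrix_j w (k j)) \in [:: 0; 1; -1].
Proof.
have [uk|nk] := boolP (\matrix_j f (k j) \in unitmx).
  have [X [X_min X_dual]] := dual_minimal uk.
  pose W := \matrix_j w (k j); pose XM := \matrix_j X j.
  have wX i j : `|(W *m XM^T)%R i j|%N = (i == j).
    have -> : (W *m XM^T) i j = dot (w (k i)) (X j).
      by rewrite mxE dotE; apply: eq_bigr => l _; rewrite !mxE.
    by rewrite w_lift // X_dual; case: (i == j).
  have dD : W *m XM^T = diag_mx (\row_i (W *m XM^T) i i).
    apply/matrixP=> i j; rewrite [RHS]mxE [X in _ = X *+ _]mxE.
    case: eqVneq => [->//|ij].
    by apply/eqP; rewrite -absz_eq0 wX (negbTE ij).
  have : `|\det (W *m XM^T)| = 1.
    rewrite dD det_diag normr_prod big1 // => i _.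
    by rewrite mxE -abszE wX eqxx.
  rewrite det_mulmx normrM -!abszE -PoszM => /eqP.
  by rewrite eqz_nat muln_eq1 => /andP[/eqP d1 _]; exact: absz1_mem.
have [a [a0 ak]] : exists a : lattice_mod2 g,
    a <> 0 /\ forall j, dot (f (k j)) a = 0.
  apply: contra_notP (negP nk) => na; apply: separating_unit => a ak.
  by apply: contrapT => a0; apply: na; exists a.
have [x mx xa] := minimal_exists a.
have x0 : x != 0 by apply: contra_not_neq a0 => x0; rewrite -xa x0 mod2_0.
suff /eqP -> : \det (\matrix_j w (k j)) == 0 by rewrite inE.
rewrite -det_tr; apply/det0P; exists x => //; apply/rowP=> j.
have := w_lift (k j) mx; rewrite xa ak => /eqP; rewrite absz_eq0 => /eqP wx.
rewrite [RHS]mxE -wx dotC dotE mxE.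
by apply: eq_bigr => i _; rewrite !mxE.
Qed.

Hypothesis f_support : forall F : lattice_mod2 g -> R,
  \sum_u lam u * F u = \sum_e lam (f e) * F (f e).

Let polar_gap (x y : 'rV[R]_g) := B x y -
  \sum_e lam (f e) * (dot (realify R (w e)) x * dot (realify R (w e)) y).

Let polar_gapC x y : polar_gap x y = polar_gap y x.
Proof.
rewrite /polar_gap polar_sym; congr (_ - _); apply: eq_bigr => e _.
by rewrite [dot _ x * _]mulrC.
Qed.

Let polar_gapP c x z y :
  polar_gap (c *: x + z) y = c * polar_gap x y + polar_gap z y.
Proof.
rewrite /polar_gap linearPl /=; under eq_bigr => e _ do rewrite dotDr dotZr.
have -> : \sum_e lam (f e) * ((c * dot (realify R (w e)) x +
      dot (realify R (w e)) z) * dot (realify R (w e)) y) =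
    c * (\sum_e lam (f e) *
      (dot (realify R (w e)) x * dot (realify R (w e)) y)) +
    \sum_e lam (f e) * (dot (realify R (w e)) z * dot (realify R (w e)) y).
  rewrite mulr_sumr -big_split; apply: eq_bigr => e _ /=.
  by ring.
by ring.
Qed.

Let polar_gap0 y : polar_gap 0 y = 0.
Proof. by have := polar_gapP 1 0 0 y; rewrite scaler0 addr0; lra. Qed.

Let polar_gapZ c x y : polar_gap (c *: x) y = c * polar_gap x y.
Proof. by rewrite -[c *: x]addr0 polar_gapP polar_gap0 addr0. Qed.

Let polar_gap_minimal z :
  minimal z -> polar_gap (realify R z) (realify R z) = 0.
Proof.
move=> mz; rewrite /polar_gap -QB mz vonormE f_support.
apply/eqP; rewrite subr_eq0; apply/eqP; apply: eq_bigr => e _.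
rewrite !dot_realify -intrM /parity -w_lift // natr_absz.
have le1 : `|dot (w e) z| <= 1.
  by rewrite -abszE w_lift // lez_nat -ltnS (leq_trans (ltn_ord _)).
have -> // : dot (w e) z * dot (w e) z = `|dot (w e) z| by nia.
Qed.

Let polar_gap_eq0 x y : polar_gap x y = 0.
Proof.
have [u lu uu] := basis_of_separating support_separates.
have [X [X_min X_dual]] := dual_minimal uu.
pose XR : 'M[R]_g := \matrix_j realify R (X j).
have uX : XR \in unitmx.
  have [C CX] := basis_left_inverse lu uu X_min X_dual.
  apply: (@mulmx1_unit _ _ (map_mx intr C) _ _).2.
  have -> : XR = map_mx intr (\matrix_j X j).
    by apply/matrixP=> i j; rewrite !mxE.
  by rewrite -map_mxM CX map_mx1.
have gapX i j : polar_gap (realify R (X i)) (realify R (X j)) = 0.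
  have gap_ii k : polar_gap (realify R (X k)) (realify R (X k)) = 0.
    exact: polar_gap_minimal.
  have [->//|ij] := eqVneq i j.
  (* A minimal z in the class of X i + X j is +- X i +- X j. *)
  have [z mz zE] := minimal_exists (mod2 (X i) + mod2 (X j)).
  have [c cz ci] := minimal_coords lu uu X_min X_dual mz.
  have cE k : `|c 0%R k|%N = ((k == i) + (k == j))%N.
    rewrite ci zE dotDr !X_dual; have [->|_] := eqVneq k i; last by case: eqP.
    by rewrite (negbTE ij).
  have zij : z = c 0 i *: X i + c 0 j *: X j.
    rewrite cz mulmx_sum_row (bigD1 i) //= (bigD1 j) 1?eq_sym //=.
    rewrite big1 ?addr0 => [|k]; first by rewrite !rowK.
    move=> /andP[ki kj]; have /eqP := cE k.
    by rewrite (negbTE ki) (negbTE kj) absz_eq0 => /eqP ->; rewrite scale0r.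
  have nz k : (k == i) || (k == j) -> (c 0 k)%:~R != 0 :> R.
    move=> kij; rewrite intr_eq0 -absz_eq0 cE; move: kij.
    by case: (k == i) => //= ->.
  have ci0 : (c 0 i)%:~R != 0 :> R by rewrite nz ?eqxx.
  have cj0 : (c 0 j)%:~R != 0 :> R by rewrite nz ?eqxx ?orbT.
  have := polar_gap_minimal mz; rewrite zij.
  have -> : realify R (c 0 i *: X i + c 0 j *: X j) =
      (c 0 i)%:~R *: realify R (X i) + (c 0 j)%:~R *: realify R (X j).
    by apply/rowP=> k; rewrite !mxE intrD !intrM.
  rewrite polar_gapP polar_gapZ !(polar_gapC _ (_ + _)) !polar_gapP.
  rewrite !polar_gapZ !gap_ii (polar_gapC (realify R (X j))) => /eqP.
  rewrite !(mulr0, addr0, add0r) mulrCA -mulrDr -mulrDl -mulr2n -mulr_natl.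
  by rewrite !mulf_eq0 (negbTE ci0) (negbTE cj0) pnatr_eq0 => /eqP.
have spanX y' : (forall i, polar_gap (realify R (X i)) y' = 0) ->
    forall v, polar_gap v y' = 0.
  move=> y0 v; rewrite -(mulmxKV uX v) mulmx_sum_row.
  elim/big_ind: _ => [|s t s0 t0|i _]; first exact: polar_gap0.
    by rewrite -[s]scale1r polar_gapP s0 t0 mulr0 addr0.
  by rewrite rowK polar_gapZ y0 mulr0.
apply: (spanX y) => i; rewrite polar_gapC; apply: (spanX _) => j.
exact: gapX.
Qed.

(** Both sides agree on minimal vectors, and a symmetric bilinear form is zero
    as soon as its quadratic form vanishes on every X i and on some
    +- X i +- X j for all i <> j, where X is a basis. *)
Lemma sum_of_lifts x :
  Q x = \sum_e lam (f e) * dot (realify R (w e)) x ^+ 2.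
Proof.
by have /eqP := polar_gap_eq0 x x; rewrite /polar_gap -QB subr_eq0 => /eqP ->.
Qed.

End Lifts.

Lemma cut_vonorms_matroidal : matroidal Q.
Proof.
pose S := [pred u | 0 < lam u].
have /fin_all_exists[w wP] (e : {u | u \in S}) :
    exists w : lattice g, forall z, minimal z ->
      `|dot w z|%N = dot (\val e) (mod2 z) :> nat.
  exact: support_lift (valP e).
exists {u | u \in S}, (fun e => dot_form (w e)), (fun e => lam (val e)); split.
- apply/unimodular_coefs => k.
  have -> : \matrix_j coefs (dot_form (w (k j))) = \matrix_j w (k j).
    by apply/row_matrixP=> j; rewrite !rowK /= dot_formK.
  exact: (lifts_unimodular wP).
- by move=> e; apply: (valP e).
move=> x; rewrite (sum_of_lifts wP) => [|F].
  by apply: eq_bigr => e _ /=; rewrite realify_dualE dot_formK.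
rewrite -(big_sub S (fun u => lam u * F u)) [RHS]big_mkcond /=.
apply: eq_bigr => u _; case: ifPn => //; rewrite inE -leNgt => lu.
have -> : lam u = 0 by apply/eqP; rewrite eq_le lu lam_ge0.
by rewrite mul0r.
Qed.

End ConormsToMatroidal.

(** * The criterion *)

Theorem corollary7p2 (R : realType) (g : nat) (Q : 'rV[R]_g -> R)
    (hQ : positive_definite Q) :
  matroidal Q <->
  (forall e : lattice_mod2_dual g, e != 0 -> 0 <= conorm Q e).
Proof.
split=> [[E [a [lam [ua lam0 QE]]]] e|conorm_ge0].
  exact: (matroidal_conorm_ge0 ua lam0 QE hQ).
have [[B QB] _] := hQ.
(* The cut of u = 0 is empty, so its weight is free; the conorm at 0 itself
   is not positive. *)
pose lam (u : lattice_mod2 g) := if u == 0 then 0 else conorm Q (dot_form u).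
apply: (cut_vonorms_matroidal (lam := lam) hQ QB) => [u||a].
- by rewrite /lam; case: eqP => // /eqP u0; rewrite conorm_ge0 // dot_form_eq0.
- by rewrite /lam eqxx.
have Q00 : Q (realify R 0) = 0.
  by rewrite (_ : realify R 0 = 0) ?(quadratic0 QB) // /realify map_mx0.
rewrite vonorm_of_conorms; last first.
  have [x _ [vx vmin]] := vonorm_min (0 : lattice_mod2 g) hQ.
  apply/eqP; rewrite eq_le -{1}Q00 vmin ?mod2_0 //= vx.
  by rewrite (quadratic_ge0 hQ QB).
apply: eq_bigr => u _; rewrite /lam; case: eqP => // ->.
by rewrite dotC dot0r /parity mulr0 mul0r.
Qed.
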